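(* Let $n,k$ be positive integers and let $\alpha=(\alpha_1,\ldots,\alpha_k)$ be integers with $n\ge\alpha_1\ge\alpha_2\ge\cdots\ge\alpha_k\ge 0$. Define the following finite sets of cells (cell $(i,j)$ lies in row $i$ and column $j$; rows are numbered from bottom to top, columns from left to right): $$D=\{(i,j)\mid 1\le i\le k,\ 1\le j\le \alpha_{k-i+1}\},\qquad R=\{(i,j)\mid 1\le i\le k,\ 1\le j\le n\},$$ $$T=\{(i,j)\mid 1\le i\le k,\ \alpha_1-\alpha_i+1\le j\le n+\alpha_1-\alpha_i\},$$ $$V=\{(i,j)\mid k+1\le i\le 2k,\ n+\alpha_1-\alpha_{i-k}+1\le j\le n+\alpha_1\},\qquad SQ=T\cup V.$$ Then, as multisets, $$AL(SQ)=AL(R)\uplus AL(D),$$ where $\uplus$ denotes multiset union (sum of multiplicities).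
   Context: For a finite set of cells $G$ (a skew diagram) and a cell $x\in G$: the arm length $a_G(x)$ is the number of cells of $G$ in the same row as $x$ and to the right of $x$; the leg length $l_G(x)$ is the number of cells of $G$ in the same column as $x$ and below $x$ (recall rows are numbered from bottom to top, so ''below'' means smaller row index). $AL(G)$ denotes the multiset $\{(a_G(x),l_G(x))\mid x\in G\}$ of arm–leg pairs over all cells of $G$. *)

(* Defs.v *)
From mathcomp Require Import all_boot.
From mathcomp Require Export finmap multiset.

Set Implicit Arguments.
Unset Strict Implicit.
Unset Printing Implicit Defensive.

Local Open Scope fset_scope.
Local Open Scope nat_scope.

(* The cell [(i, j)] lies in row [i] and column [j]; rows are numbered from
   bottom to top and columns from left to right. *)
Notation cell := (nat * nat)%type.

Definition arm (G : {fset cell}) (x : cell) : nat :=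
  #|` [fset y in G | (y.1 == x.1) && (x.2 < y.2)]|.

Definition leg (G : {fset cell}) (x : cell) : nat :=
  #|` [fset y in G | (y.2 == x.2) && (y.1 < x.1)]|.

Definition AL (G : {fset cell}) : {mset nat * nat}%mset :=
  seq_mset [seq (arm G x, leg G x) | x <- enum_fset G].

(* Inclusive at both ends, unlike [index_iota]. *)
Definition interval (a b : nat) : seq nat := index_iota a b.+1.

(* [part alpha i] is alpha_i with 1-based indexing; it is only used for
   [1 <= i <= k]. *)
Definition part (k : nat) (alpha : k.-tuple nat) (i : nat) : nat :=
  nth 0 alpha i.-1.

(* For nonincreasing [alpha] bounded by [n], none of the subtractions below
   truncates. *)
Definition shapeD (k : nat) (alpha : k.-tuple nat) : {fset cell} :=
  [fset (i, j) | i : nat in interval 1 k, j : nat in interval 1 (part alpha (k - i + 1))].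

Definition shapeR (n k : nat) : {fset cell} :=
  [fset (i, j) | i : nat in interval 1 k, j : nat in interval 1 n].

Definition shapeT (n k : nat) (alpha : k.-tuple nat) : {fset cell} :=
  [fset (i, j) | i : nat in interval 1 k,
     j : nat in interval (part alpha 1 - part alpha i + 1)
                   (n + part alpha 1 - part alpha i)].

Definition shapeV (n k : nat) (alpha : k.-tuple nat) : {fset cell} :=
  [fset (i, j) | i : nat in interval (k + 1) (2 * k),
     j : nat in interval (n + part alpha 1 - part alpha (i - k) + 1)
                   (n + part alpha 1)].

Definition shapeSQ (n k : nat) (alpha : k.-tuple nat) : {fset cell} :=
  shapeT n alpha `|` shapeV n alpha.

(* Main.v *)
Require Import Defs.
From mathcomp Require Import all_boot.
From mathcomp Require Import finmap multiset zify.

(** Every shape has interval rows, so each row of length [m] contains exactly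
one cell of each arm length [a < m], and the multisets can be compared one arm
length at a time.  Fix [a < n] and write [x_0 >= ... >= x_(k-1)] for [alpha].
The [i]-th row of [T] has leg [#{r < i | x_r <= x_i + a}], the [i]-th row of [V]
(if [x_i > a]) has leg [i + #{r | x_r <= a}], the rows of [R] have legs
[0, ..., k-1], and the row of [D] of length [x_i > a] has leg
[g_i = #{r > i | x_i <= x_r + a}].  With [m = #{r | x_r > a}], the legs in [V]
are [k-m, ..., k-1]; the remaining legs [0, ..., k-m-1] of [R] are the values
[g_i = k-1-i] for the [i] with [x_i <= a].  So it remains to see that the legs
of [T] and all of [g_0, ..., g_(k-1)] agree as multisets. *)

(** * Sums of indicators and comparison of multiplicities *)

Lemma count_iota0 (p : pred nat) n :
  count p (iota 0 n) = \sum_(0 <= i < n) p i.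
Proof.
rewrite -sum1_count big_mkcond /index_iota subn0.
by apply: eq_bigr => i _; case: (p i).
Qed.

(** The indices satisfying [p] form an initial segment, whose length is the sum; [l] is below this
    length exactly when [l] lies in the segment. *)
Lemma ltn_sum_initial (p : pred nat) n l :
  (forall i j, i <= j < n -> p j -> p i) ->
  (l < \sum_(0 <= i < n) p i) = (l < n) && p l.
Proof.
elim: n p l => [|n IHn] p l p_init; first by rewrite big_nil.
rewrite big_nat_recl //; case p0: (p 0); last first.
  rewrite big_nat big1 => [|i /andP[_ lt_in]].
    by rewrite ltn0; apply/esym; apply: contraFF p0 => /andP[lt_ln]; apply: p_init.
  by apply/eqP; rewrite eqb0; apply: contraFN p0; apply: p_init.
case: l => [|l]; first by rewrite p0.
by rewrite add1n !ltnS IHn // => i j le_ij; apply: p_init.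
Qed.

Lemma ltn_sum_final (p : pred nat) n l :
  (forall i j, i <= j < n -> p i -> p j) ->
  (l < \sum_(0 <= i < n) p i) = (l < n) && p (n - l.+1).
Proof.
move=> p_final; rewrite big_nat_rev /= add0n.
rewrite (ltn_sum_initial (fun i => p (n - i.+1))) //.
by move=> i j /andP[le_ij lt_jn]; apply: p_final; lia.
Qed.

(** The multiplicity of [l] is a difference of two tail counts. This replaces equations between legs
    by inequalities, which the two lemmas above can decide. *)
Lemma sum_eq_of_sum_gt (f g : nat -> nat) k :
  (forall l, \sum_(0 <= i < k) (l < f i) = \sum_(0 <= i < k) (l < g i)) ->
  forall l, \sum_(0 <= i < k) (f i == l) = \sum_(0 <= i < k) (g i == l).
Proof.
move=> eq_gt l.
have split_ge h : \sum_(0 <= i < k) (l <= h i) =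
    \sum_(0 <= i < k) (h i == l) + \sum_(0 <= i < k) (l < h i).
  by rewrite -big_split; apply: eq_bigr => i _ /=; lia.
have: \sum_(0 <= i < k) (l <= f i) = \sum_(0 <= i < k) (l <= g i).
  (* For [l = 0] both counts are [k]; otherwise they are strict tail counts at the predecessor. *)
  by case: l {split_ge} => [|l]; [rewrite !big_nat | apply: eq_gt].
by rewrite !split_ge eq_gt => /addIn.
Qed.

(** * Leg counts for a nonincreasing sequence *)

Section Nonincreasing.

Variables (x : nat -> nat) (k : nat).
Hypothesis x_noninc : forall i j, i <= j < k -> x j <= x i.

(* The [i]-th inner sum exceeds [l] exactly when [x] changes by at most [a]
   between [i] and the position [l + 1] places before it (on the left) or after
   it (on the right); both sides thus count the same pairs of positions. *)
Lemma close_before_after a l :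
  \sum_(0 <= i < k) (\sum_(0 <= r < i) (x r <= x i + a) == l) =
  \sum_(0 <= i < k) (\sum_(i.+1 <= r < k) (x i <= x r + a) == l).
Proof.
apply: sum_eq_of_sum_gt => {}l.
transitivity (\sum_(0 <= i < k) ((l < i) && (x (i - l.+1) <= x i + a))).
  apply: eq_big_nat => i /andP[_ lt_ik]; congr nat_of_bool.
  rewrite (ltn_sum_final (fun r => x r <= x i + a)) // => r s le_rs.
  by apply: leq_trans; apply: x_noninc; lia.
transitivity (\sum_(0 <= i < k) ((i + l.+1 < k) && (x i <= x (i + l.+1) + a))).
  have [le_kl|lt_lk] := leqP k l.+1.
    rewrite !big_nat !big1 // => i /andP[_ lt_ik]; last by case: ltnP => //; lia.
    by case: ltnP => //; lia.
  (* The first [l.+1] terms on the left and the last [l.+1] on the right vanish; the others match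
     under a shift by [l.+1]. *)
  rewrite (big_cat_nat (n := l.+1)) //=; last lia.
  rewrite [RHS](big_cat_nat (n := k - l.+1)) //=; last lia.
  rewrite big_nat big1 => [|i lt_i]; last by case: ltnP => //; lia.
  rewrite [X in _ = _ + X]big_nat [X in _ = _ + X]big1 => [|i lt_i]; last first.
    by case: ltnP => //; lia.
  rewrite add0n addn0 -{1}[l.+1]add0n big_addn; apply: eq_big_nat => i lt_i.
  by congr nat_of_bool; rewrite addnK; congr andb; lia.
apply: eq_big_nat => i /andP[_ lt_ik]; congr nat_of_bool.
rewrite -[i.+1]add0n big_addn.
rewrite (ltn_sum_initial (fun r => x i <= x (r + i.+1) + a)) => [|r s le_rs].
  by rewrite /= [l + i.+1]addnC addSnnS; congr andb; lia.
move=> /leq_trans; apply; rewrite leq_add2r; apply: x_noninc; lia.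
Qed.

Lemma ltn_noninc a i : i < k ->
  (a < x i) = (i < \sum_(0 <= r < k) (a < x r)).
Proof.
move=> lt_ik; rewrite (ltn_sum_initial (fun r => a < x r)) ?lt_ik // => r s le_rs.
by move=> /leq_trans; apply; apply: x_noninc.
Qed.

(** For [a < n], the four sums count, in order, the rows of [T], [V], [R] and [D] whose cell of arm
    length [a] has leg [l]. *)
Lemma legs_balance a l :
  \sum_(0 <= i < k) (\sum_(0 <= r < i) (x r <= x i + a) == l) +
  \sum_(0 <= i < k) ((a < x i) && (i + \sum_(0 <= r < k) (x r <= a) == l)) =
  \sum_(0 <= i < k) (i == l) +
  \sum_(0 <= i < k)
     ((a < x i) && (\sum_(i.+1 <= r < k) (x i <= x r + a) == l)).
Proof.
rewrite close_before_after.
set m := \sum_(0 <= r < k) (a < x r).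
have mE : \sum_(0 <= r < k) (x r <= a) + m = k.
  rewrite -big_split /= -[RHS]muln1 -[k in RHS]subn0 -sum_nat_const_nat.
  by apply: eq_bigr => r _; case: ltnP.
have -> : \sum_(0 <= i < k) (i == l) =
    \sum_(0 <= i < k) ((a < x i) && (i + \sum_(0 <= r < k) (x r <= a) == l)) +
    \sum_(0 <= i < k) ((x i <= a) && (k - i.+1 == l)).
  (* Cut the legs of [R] at [k - m]: the upper ones are shifted onto the indices [i < m], the lower
     ones are reversed onto the indices [i >= m]. *)
  rewrite (big_cat_nat (n := \sum_(0 <= r < k) (x r <= a))) //=; last lia.
  rewrite addnC; congr (_ + _).
    rewrite [RHS](big_cat_nat (n := m)) //=; last lia.
    rewrite [X in _ = _ + X]big_nat [X in _ = _ + X]big1 => [|i lt_i]; last first.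
      by rewrite ltn_noninc -/m; lia.
    rewrite addn0 -{1}[\sum_(0 <= r < k) (x r <= a)]add0n big_addn.
    have -> : k - \sum_(0 <= r < k) (x r <= a) = m by lia.
    by apply: eq_big_nat => i lt_i; rewrite ltn_noninc -/m; lia.
  rewrite [RHS](big_cat_nat (n := m)) //=; last lia.
  rewrite [X in _ = X + _]big_nat [X in _ = X + _]big1 => [|i lt_i]; last first.
    by rewrite leqNgt ltn_noninc -/m; lia.
  rewrite add0n big_nat_rev /= -[m in RHS]add0n big_addn.
  have -> : k - m = \sum_(0 <= r < k) (x r <= a) by lia.
  by apply: eq_big_nat => i lt_i; rewrite [x _ <= a]leqNgt ltn_noninc -/m; lia.
rewrite addnC -addnA; congr (_ + _).
rewrite addnC -big_split; apply: eq_big_nat => i lt_i /=.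
case: ltnP => /= [_|le_xa]; first by rewrite addn0.
have -> : \sum_(i.+1 <= r < k) (x i <= x r + a) = k - i.+1; last by [].
rewrite -[RHS]muln1 -sum_nat_const_nat; apply: eq_bigr => r _.
by rewrite (leq_trans le_xa) ?leq_addl.
Qed.

End Nonincreasing.

(** * Arm-leg pairs of a shape with interval rows, indexed from 0 *)

Section RowShape.

Variables (G : {fset cell}) (K : nat) (lo len : nat -> nat).
Hypothesis memG : forall i j, ((i, j) \in G) =
  [&& 0 < i, i <= K & lo i.-1 < j <= lo i.-1 + len i.-1].

Lemma arm_row i j : i < K -> lo i < j <= lo i + len i ->
  arm G (i.+1, j) = lo i + len i - j.
Proof.
move=> lt_iK /andP[lo_j j_hi]; rewrite /arm.
rewrite -[RHS](size_iota j.+1) -[RHS](size_map (pair i.+1)); apply: perm_size.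
apply: uniq_perm; rewrite ?fset_uniq ?map_inj_uniq ?iota_uniq //.
  by move=> ? ? [].
move=> [r c]; rewrite !inE memG /=; apply/idP/mapP => [|[d]].
  case/andP=> c_row /andP[/eqP r_i lt_jc]; move: c_row; rewrite r_i => /= c_row.
  by exists c => //; rewrite mem_iota; lia.
rewrite mem_iota => ? [-> ->] /=; lia.
Qed.

Lemma leg_row i j : i < K ->
  leg G (i.+1, j) = \sum_(0 <= r < i) (lo r < j <= lo r + len r).
Proof.
move=> lt_iK; rewrite -(count_iota0 (fun r => lo r < j <= lo r + len r)).
rewrite -size_filter -[RHS](size_map (fun r => (r.+1, j))); apply: perm_size.
apply: uniq_perm; rewrite ?fset_uniq ?map_inj_uniq ?filter_uniq ?iota_uniq //.
  by move=> ? ? [].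
move=> [r c]; rewrite !inE memG /=; apply/idP/mapP => [|[d]].
  case/andP=> r_col /andP[/eqP c_j lt_ri]; move: r_col; rewrite c_j => r_col.
  exists r.-1; last by rewrite prednK //; lia.
  rewrite mem_filter mem_iota; lia.
rewrite mem_filter mem_iota => /andP[? ?] [-> ->] /=; lia.
Qed.

(** The only possible cell of arm length [a] in row [i.+1] is in column [lo i + len i - a]; the
    inner sum is its leg. *)
Lemma AL_rows a l : AL G (a, l) =
  \sum_(0 <= i < K) ((a < len i) &&
    (\sum_(0 <= r < i)
       (lo r < lo i + len i - a <= lo r + len r) == l)).
Proof.
(* Each row is parametrised by the arm length [b] of its cells. *)
pose col i b := lo i + len i - b.
have permG : perm_eq (enum_fset G)
    [seq (i.+1, col i b) | i <- iota 0 K, b <- iota 0 (len i)].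
  apply: uniq_perm => [||[i j]]; first exact: fset_uniq.
    apply: allpairs_uniq_dep => [|i _|]; rewrite ?iota_uniq //.
    move=> _ _ /allpairsPdep[i [b [_ b_i ->]]] /allpairsPdep[r [c [_ c_r ->]]] /=.
    case=> eq_ir; move: c c_r; rewrite -eq_ir => c c_i.
    move: b_i c_i; rewrite /col !mem_iota => b_i c_i eq_bc.
    by have -> : b = c by lia.
  rewrite memG; apply/idP/allpairsPdep => [ij_in|[r [b []]]].
    exists i.-1, (lo i.-1 + len i.-1 - j); rewrite !mem_iota /col.
    split; [lia | lia | congr pair; lia].
  rewrite !mem_iota /col => ? ? [-> ->] /=; lia.
rewrite mset_seqE (permP (perm_map _ permG)) map_allpairs count_flatten.
rewrite sumnE !big_map /index_iota subn0 big_seq [RHS]big_seq.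
apply: eq_bigr => i; rewrite mem_iota => /andP[_ lt_iK].
rewrite count_map.
(* Only [b = a] counts, so the leg condition can be made independent of [b] and pulled out. *)
transitivity (count (fun b => (b == a) && (leg G (i.+1, col i a) == l))
                (iota 0 (len i))).
  apply: eq_in_count => b; rewrite mem_iota => /andP[_ lt_b] /=.
  rewrite arm_row /col //; last lia.
  have -> : lo i + len i - (lo i + len i - b) = b by lia.
  by rewrite xpair_eqE; case: eqP => [->|].
rewrite leg_row //; case: (_ == l); last first.
  by rewrite andbF (eq_count (a2 := pred0)) ?count_pred0 // => b; rewrite andbF.
rewrite andbT (eq_count (a2 := pred1 a)) => [|b]; last by rewrite /= andbT.
by rewrite count_uniq_mem ?iota_uniq // mem_iota.
Qed.

End RowShape.

(** * The shapes [R], [D] and [SQ] *)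

Lemma mem_interval a b i : (i \in interval a b) = (a <= i <= b).
Proof. by rewrite mem_index_iota ltnS. Qed.

Lemma mem_rows (s : seq nat) (lo hi : nat -> nat) i j :
  ((i, j) \in [fset (i, j) | i : nat in s, j : nat in interval (lo i) (hi i)]%fset)
  = (i \in s) && (lo i <= j <= hi i).
Proof.
apply/imfset2P/andP => [[r /= s_r [c /= rc]]|[s_i ij]].
  by case=> -> ->; rewrite s_r -mem_interval.
by exists i => //; exists j => //=; rewrite mem_interval.
Qed.

Section Shapes.

Variables (n k : nat) (alpha : k.-tuple nat).
Let x := nth 0 alpha.
Hypothesis x_noninc : forall i j, i <= j < k -> x j <= x i.
Hypothesis x_le_n : forall i, i < k -> x i <= n.

Lemma AL_shapeR a l :
  AL (shapeR n k) (a, l) = \sum_(0 <= i < k) ((a < n) && (i == l)).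
Proof.
rewrite (AL_rows _ k (fun=> 0) (fun=> n)) => [|i j]; last first.
  by rewrite (mem_rows _ (fun=> 1) (fun=> n)) mem_interval; lia.
apply: eq_bigr => i _; case: ltnP => //= lt_an.
rewrite (eq_bigr (fun=> 1)) => [|r _]; last by lia.
by rewrite sum_nat_const_nat subn0 muln1.
Qed.

Lemma AL_shapeD a l :
  AL (shapeD alpha) (a, l) = \sum_(0 <= i < k)
     ((a < x i) && (\sum_(i.+1 <= r < k) (x i <= x r + a) == l)).
Proof.
rewrite (AL_rows _ k (fun=> 0) (fun i => x (k - i.+1)))
  => [|i j]; last first.
  rewrite (mem_rows _ (fun=> 1) (fun i => part alpha (k - i + 1))) mem_interval.
  rewrite /part addn1 /= -/x -andbA; case: i => //= i.
(* The rows of [D] list [alpha] backwards; reversing the outer and inner sums turns the rows below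
   into the indices [r > i]. *)
rewrite big_nat_rev; apply: eq_big_nat => i /andP[_ lt_ik] /=.
have -> : k - (0 + k - i.+1).+1 = i by lia.
case: ltnP => //= lt_ax; congr (nat_of_bool (_ == l)).
rewrite -[i.+1 in RHS]add0n big_addn [RHS]big_nat_rev /= add0n.
apply: eq_big_nat => r lt_r.
have -> : k - i.+1 - r.+1 + i.+1 = k - r.+1 by lia.
by rewrite !add0n subn_gt0 lt_ax leq_subLR addnC.
Qed.

Lemma AL_shapeSQ a l : AL (shapeSQ n alpha) (a, l) =
  \sum_(0 <= i < k) ((a < n) && (\sum_(0 <= r < i) (x r <= x i + a) == l)) +
  \sum_(0 <= i < k) ((a < x i) && (i + \sum_(0 <= r < k) (x r <= a) == l)).
Proof.
have x_le_x0 i : i < k -> x i <= x 0 by move=> lt_ik; apply: x_noninc.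
rewrite (AL_rows _ (k + k)
  (fun i => if i < k then x 0 - x i else n + x 0 - x (i - k))
  (fun i => if i < k then n else x (i - k))) => [|i j]; last first.
  rewrite in_fsetU.
  rewrite (mem_rows _ (fun i => part alpha 1 - part alpha i + 1)
                      (fun i => n + part alpha 1 - part alpha i)).
  rewrite (mem_rows _ (fun i => n + part alpha 1 - part alpha (i - k) + 1)
                      (fun=> n + part alpha 1)).
  rewrite !mem_interval /part /= -/x !addn1 mul2n -addnn.
  case: i => //= i; case: ltnP => [lt_ik|le_ki].
    by have := x_le_x0 i lt_ik; lia.
  have [lt_ikk|] := ltnP i (k + k); last by lia.
  have -> : (i.+1 - k).-1 = i - k by lia.
  have lt_ik : i - k < k by lia.
  by have := x_le_x0 _ lt_ik; have := x_le_n _ lt_ik; lia.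
rewrite (big_cat_nat (n := k)) ?leq_addr //=; congr (_ + _).
  apply: eq_big_nat => i /andP[_ lt_ik]; rewrite lt_ik.
  case: ltnP => //= lt_an; congr (nat_of_bool (_ == l)).
  (* Row [r] of [T] starts no further right than row [i], so only its right end matters. *)
  apply: eq_big_nat => r /andP[_ lt_ri]; rewrite (ltn_trans lt_ri lt_ik).
  have := x_noninc r i; have := x_le_x0 _ lt_ik.
  by have := x_le_x0 _ (ltn_trans lt_ri lt_ik); lia.
rewrite -{1}[k]add0n big_addn addnK; apply: eq_big_nat => i /andP[_ lt_ik].
have -> : i + k < k = false by lia.
rewrite addnK; case: ltnP => //= lt_ax; congr (nat_of_bool (_ == l)).
have x_le_x0_i := x_le_x0 _ lt_ik; have x_le_n_i := x_le_n _ lt_ik.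
(* All rows of [V] end in column [n + x 0], so the cell lies in column [n + x 0 - a]. Each of the
   [i] lower rows of [V] is at least as long as this one and meets that column; row [r] of [T] meets
   it iff [x r <= a]. *)
rewrite (big_cat_nat (n := k)) ?leq_addl //= addnC; congr (_ + _).
  rewrite -{1}[k]add0n big_addn addnK.
  rewrite (eq_big_nat _ _ (F2 := fun=> 1)) => [|r /andP[_ lt_ri]].
    by rewrite sum_nat_const_nat subn0 muln1.
  have -> : r + k < k = false by lia.
  have lt_rk := ltn_trans lt_ri lt_ik.
  have := x_noninc r i; have := x_le_x0 _ lt_rk.
  by rewrite addnK; have := x_le_n _ lt_rk; lia.
apply: eq_big_nat => r /andP[_ lt_rk]; rewrite lt_rk.
by have := x_le_x0 _ lt_rk; have := x_le_n _ lt_rk; lia.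
Qed.

End Shapes.

Theorem theorem1p2 (n k : nat) (alpha : k.-tuple nat)
    (n_gt0 : 0 < n) (k_gt0 : 0 < k)
    (alpha_noninc : sorted geq alpha) (alpha1_le_n : part alpha 1 <= n) :
  AL (shapeSQ n alpha) = (AL (shapeR n k) `+` AL (shapeD alpha))%mset.
Proof.
have x_noninc i j : i <= j < k -> nth 0 alpha j <= nth 0 alpha i.
  case/andP=> le_ij lt_jk.
  apply: (sorted_leq_nth (leT := geq)) => //; rewrite ?inE ?size_tuple //.
  - by move=> p q r /= le_pq le_rp; apply: leq_trans le_rp le_pq.
  - by move=> p /=.
  - exact: leq_ltn_trans le_ij lt_jk.
have x_le_n i : i < k -> nth 0 alpha i <= n.
  by move=> lt_ik; apply: leq_trans alpha1_le_n; apply: x_noninc.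
apply/msetP => -[a l]; rewrite msetE2 AL_shapeSQ // AL_shapeR AL_shapeD.
have [lt_an|le_na] := ltnP a n; first exact: legs_balance.
(* No row is longer than [n], so for [a >= n] all terms on both sides vanish. *)
have a_nlt i : 0 <= i < k -> (a < nth 0 alpha i) = false.
  by move=> lt_ik; apply/negbTE; rewrite -leqNgt (leq_trans _ le_na) ?x_le_n.
congr (_ + _).
by apply: eq_big_nat => i lt_ik; rewrite a_nlt.
Qed.
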